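(* Let $P$ be a finite poset and let $L$ be its ideal lattice. Then the following conditions are equivalent: (a) $L$ is a URC lattice. (b) Either $P$ is a chain or it consists of two disjoint chains $C$ and $D$ such that all elements of $C$ are incomparable with all elements of $D$. (c) There exist non-negative integers $m$ and $n$ such that $L\cong[m]_0\times[n]_0$.
   Context: The ideal lattice of a finite poset $P$ is the lattice of all poset ideals (down-closed subsets, including $\emptyset$) of $P$, ordered by inclusion. For an interval $[a,b]$ of a lattice $L$ and $c,d\in[a,b]$, the set $\{c,d\}$ is a complementary set of $[a,b]$ if $c\vee d=b$, $c\wedge d=a$ and $\{c,d\}\ne\{a,b\}$. $L$ is a URC lattice (uniquely relatively complemented) if for every interval $[a,b]$ of $L$ either $[a,b]$ is a chain or there exists a unique complementary set of $[a,b]$. For an integer $k\ge0$, $[k]_0=\{0,1,\dots,k\}$ with the usual order, and $[m]_0\times[n]_0$ carries the componentwise order. *)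

(* Defs.v *)
From HB Require Import structures.
From mathcomp Require Import all_boot all_order interval finmap.

Set Implicit Arguments.
Unset Strict Implicit.
Unset Printing Implicit Defensive.

Import Order.Theory.
Local Open Scope order_scope.

Section IdealLattice.

Variables (d : Order.disp_t) (P : finPOrderType d).

Definition is_ideal (A : {set P}) : bool :=
  [forall x in A, forall y, (y <= x) ==> (y \in A)].

Lemma is_idealP (A : {set P}) :
  reflect (forall x y : P, x \in A -> y <= x -> y \in A) (is_ideal A).
Proof.
apply: (iffP forall_inP) => [idA x y xA yx|idA x xA].
  by have /forallP/(_ y)/implyP := idA x xA; apply.
by apply/forallP => y; apply/implyP; apply: idA.
Qed.

Record ideal := Ideal { ideal_set :> {set P}; _ : is_ideal ideal_set }.

HB.instance Definition _ := [isSub for ideal_set].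
HB.instance Definition _ := [Finite of ideal by <:].

Implicit Types I J K : ideal.

Fact idealI_subproof I J : is_ideal (I :&: J).
Proof.
have [/is_idealP idI /is_idealP idJ] := (valP I, valP J).
apply/is_idealP => x y /setIP[xI xJ] yx.
by apply/setIP; split; [exact: idI yx|exact: idJ yx].
Qed.

Fact idealU_subproof I J : is_ideal (I :|: J).
Proof.
have [/is_idealP idI /is_idealP idJ] := (valP I, valP J).
apply/is_idealP => x y /setUP[xI|xJ] yx; apply/setUP.
  by left; exact: idI yx.
by right; exact: idJ yx.
Qed.

Definition ideal_le I J : bool := ideal_set I \subset ideal_set J.
Definition idealI I J : ideal := Ideal (idealI_subproof I J).
Definition idealU I J : ideal := Ideal (idealU_subproof I J).

Fact ideal_le_def I J : ideal_le I J = (idealI I J == I).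
Proof. by rewrite -val_eqE /=; exact/setIidPl/eqP. Qed.

Fact idealIC : commutative idealI.
Proof. by move=> I J; apply: val_inj; rewrite /= setIC. Qed.
Fact idealUC : commutative idealU.
Proof. by move=> I J; apply: val_inj; rewrite /= setUC. Qed.
Fact idealIA : associative idealI.
Proof. by move=> I J K; apply: val_inj; rewrite /= setIA. Qed.
Fact idealUA : associative idealU.
Proof. by move=> I J K; apply: val_inj; rewrite /= setUA. Qed.
Fact idealKU J I : idealI I (idealU I J) = I.
Proof. by apply: val_inj; rewrite /= setUC setKU. Qed.
Fact idealKI J I : idealU I (idealI I J) = I.
Proof. by apply: val_inj; rewrite /= setIC setKI. Qed.
Fact idealIUl : left_distributive idealI idealU.
Proof. by move=> I J K; apply: val_inj; rewrite /= setIUl. Qed.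
Fact idealII : idempotent_op idealI.
Proof. by move=> I; apply: val_inj; rewrite /= setIid. Qed.

Fact ideal_display : Order.disp_t. Proof. exact: Order.Disp tt tt. Qed.

HB.instance Definition _ := Order.isMeetJoinDistrLattice.Build ideal_display
  ideal ideal_le_def (fun _ _ => erefl) idealIC idealUC idealIA idealUA
  idealKU idealKI idealIUl idealII.

Lemma leEideal I J : (I <= J) = (ideal_set I \subset ideal_set J).
Proof. by []. Qed.

Lemma meetEideal I J : ideal_set (I `&` J) = ideal_set I :&: ideal_set J.
Proof. by []. Qed.

Lemma joinEideal I J : ideal_set (I `|` J) = ideal_set I :|: ideal_set J.
Proof. by []. Qed.

End IdealLattice.

Section URC.

Variables (d : Order.disp_t) (L : latticeType d).

Definition complementary_set (a b : L) (S : {fset L}) : Prop :=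
  exists c d : L,
    [/\ S = [fset c; d]%fset, c \in `[a, b] /\ d \in `[a, b],
        c `|` d = b, c `&` d = a & [fset c; d]%fset != [fset a; b]%fset].

Definition URC : Prop := forall a b : L, a <= b ->
  {in `[a, b] &, total <=%O} \/ exists! S : {fset L}, complementary_set a b S.

End URC.

Section Chains.

Variables (d : Order.disp_t) (P : finPOrderType d).

Definition chain (C : {set P}) : Prop := {in C &, total <=%O}.

Definition disjoint_incomparable_chains : Prop :=
  exists C D : {set P},
    [/\ C :|: D = [set: P], [disjoint C & D], chain C, chain D
      & {in C & D, forall x y : P, x >< y}].

End Chains.

(* An invertible lattice morphism is automatically an order isomorphism. *)
Definition lattice_isomorphic (d d' : Order.disp_t)
    (L : latticeType d) (L' : latticeType d') : Prop :=
  exists f : {lmorphism L -> L'}, bijective f.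

(* Main.v *)
Require Import Defs.
From HB Require Import structures.
From mathcomp Require Import all_boot all_order interval finmap.

(** (a) => (b): for an ideal lattice with property URC, any [x] and [y]
    incomparable in [P] dominate, or are dominated by, no common element [z],
    for otherwise the interval spanned by the elements of [P] between [z] and
    [x] or [y] is a non-chain without complementary set, its difference poset
    having a least or a greatest element; and [P] has no antichain of size 3,
    which would give a Boolean interval of rank 3.  Hence every element is
    comparable with exactly one of [x] and [y], and this splits [P].
    (b) => (c): send an ideal [I] to the cardinals of its traces on the two
    chains; traces of ideals on a chain are nested.
    (c) => (a): in a product of two chains, the coordinates of a complementary
    pair of [[a, b]] are those of [a] and [b] in some order. *)

Set Implicit Arguments.
Unset Strict Implicit.
Unset Printing Implicit Defensive.

(** * Complementary sets, and intervals in a product of two chains *)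

Section RelativeComplements.

Import Order.Theory.
Local Open Scope order_scope.

(** If one member of the pair is [a], the other is the join [b], and the pair is the excluded
    [{a, b}]. *)
Lemma no_complementary_set (d : Order.disp_t) (L : latticeType d) (a b : L) :
  (forall x y, x `|` y = b -> x `&` y = a -> x = a \/ y = a) ->
  forall S, ~ complementary_set a b S.
Proof.
move=> triv S [x [y [_ _ xyU xyI]]] /eqP; apply.
case: (triv _ _ xyU xyI) => e; rewrite -xyU e.
  by congr [fset _; _]%fset; apply/esym/join_r; rewrite -xyI leIr.
by rewrite fsetUC; congr [fset _; _]%fset; apply/esym/join_l; rewrite -xyI leIl.
Qed.

Lemma total_join_meet_cases (d : Order.disp_t) (T : orderType d) (a b x y : T) :
  x `|` y = b -> x `&` y = a -> (x = a /\ y = b) \/ (x = b /\ y = a).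
Proof.
move=> <- <-; rewrite joinEtotal meetEtotal; case: (leP x y) => xy.
  by left.
by right.
Qed.

Lemma URC_prod_iso (d d1 d2 : Order.disp_t) (L : latticeType d)
    (T1 : orderType d1) (T2 : orderType d2) :
  lattice_isomorphic L (T1 *p T2) -> URC L.
Proof.
move=> [f [g fK gK]] a b ab.
have fI x y : f (x `&` y) = f x `&` f y by rewrite omorphI.
have fU x y : f (x `|` y) = f x `|` f y by rewrite omorphU.
have le_f x y : (f x <= f y) = (x <= y).
  by rewrite !leEmeet -fI (can_eq fK).
have le1 x y : x <= y -> (f x).1 <= (f y).1.
  by rewrite -le_f leEprod => /andP[].
have le2 x y : x <= y -> (f x).2 <= (f y).2.
  by rewrite -le_f leEprod => /andP[].
(* If a coordinate of [f a] and [f b] agrees, it is constant on the interval, so the other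
   coordinate alone decides the order there. *)
have [eq1|ne1] := eqVneq (f a).1 (f b).1.
  left=> x y; rewrite !in_itv /= => /andP[ax xb] /andP[ay yb].
  have fst z : a <= z -> z <= b -> (f z).1 = (f a).1.
    by move=> /le1 az /le1 zb; apply/le_anti; rewrite az eq1 zb.
  by rewrite -!le_f !leEprod !fst // lexx le_total.
have [eq2|ne2] := eqVneq (f a).2 (f b).2.
  left=> x y; rewrite !in_itv /= => /andP[ax xb] /andP[ay yb].
  have snd z : a <= z -> z <= b -> (f z).2 = (f a).2.
    by move=> /le2 az /le2 zb; apply/le_anti; rewrite az eq2 zb.
  by rewrite -!le_f !leEprod !snd // lexx !andbT le_total.
(* [c] and [e] are the two remaining corners of the rectangle spanned by [f a] and [f b]. *)
right; pose c := g ((f a).1, (f b).2); pose e := g ((f b).1, (f a).2).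
have fc : f c = ((f a).1, (f b).2) by rewrite gK.
have fe : f e = ((f b).1, (f a).2) by rewrite gK.
have ceU : c `|` e = b.
  apply: (can_inj fK); rewrite fU fc fe [f b]surjective_pairing.
  by congr pair => /=; [apply/join_r/le1|apply/join_l/le2].
have ceI : c `&` e = a.
  apply: (can_inj fK); rewrite fI fc fe [f a]surjective_pairing.
  by congr pair => /=; [apply/meet_l/le1|apply/meet_r/le2].
exists [fset c; e]%fset; split.
  exists c, e; split=> //.
    by rewrite !in_itv /= -ceU -ceI leIl leIr leUl leUr.
  apply/eqP => /fsetP/(_ c); rewrite !inE eqxx /= => /esym/orP[] /eqP ca.
    by move/eqP: ne2; apply; rewrite -ca fc.
  by move/eqP: ne1; apply; rewrite -ca fc.
move=> S [x [y [-> _ xyU xyI ne]]].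
have [U1 U2] : (f x).1 `|` (f y).1 = (f b).1 /\ (f x).2 `|` (f y).2 = (f b).2.
  by rewrite -xyU fU.
have [I1 I2] : (f x).1 `&` (f y).1 = (f a).1 /\ (f x).2 `&` (f y).2 = (f a).2.
  by rewrite -xyI fI.
have fP u v : (f u).1 = (f v).1 -> (f u).2 = (f v).2 -> u = v.
  move=> uv1 uv2; apply: (can_inj fK).
  by rewrite [f u]surjective_pairing [f v]surjective_pairing uv1 uv2.
(* Parallel choices in the two coordinates give the excluded [{a, b}], crossed choices give
   [{c, e}]. *)
have [[x1 y1]|[x1 y1]] := total_join_meet_cases U1 I1;
  have [[x2 y2]|[x2 y2]] := total_join_meet_cases U2 I2.
- by case/eqP: ne; rewrite (fP x a) // (fP y b).
- by rewrite (fP x c) ?fc // (fP y e) ?fe.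
- by rewrite (fP x e) ?fe // (fP y c) ?fc // fsetUC.
- by case/eqP: ne; rewrite (fP x b) // (fP y a) // fsetUC.
Qed.

End RelativeComplements.

(** * Traces of ideals on chains, and ideals of two incomparable chains *)

Section IdealsOfChains.

Import Order.Theory.
Local Open Scope order_scope.
Context {d : Order.disp_t} {P : finPOrderType d}.
Implicit Types (C D : {set P}) (I J : ideal P).

Lemma ideal_down I x y : x \in ideal_set I -> y <= x -> y \in ideal_set I.
Proof. by move/is_idealP: (valP I); apply. Qed.

(** An element of [C] in [I] but not in [J] lies above all of [J :&: C], as it would otherwise be in
    [J] by down-closure. *)
Lemma chain_ideal_total C I J : chain C ->
  (I :&: C \subset J :&: C) || (J :&: C \subset I :&: C).
Proof.
move=> chC; apply/orP; case: (boolP (_ \subset _)); first by left.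
move=> /subsetPn[x /setIP[xI xC]]; rewrite inE xC andbT => xJ; right.
apply/subsetP => y /setIP[yJ yC]; rewrite inE yC andbT.
case/orP: (chC _ _ xC yC) => xy; last exact: ideal_down xI xy.
by rewrite (ideal_down yJ xy) in xJ.
Qed.

Lemma card_chain_idealI C I J : chain C ->
  #|(I :&: J) :&: C| = minn #|I :&: C| #|J :&: C|.
Proof.
move=> /(@chain_ideal_total _ I J)/orP[] s; rewrite setIIl.
  by rewrite (setIidPl s); apply/esym/minn_idPl/subset_leq_card.
by rewrite (setIidPr s); apply/esym/minn_idPr/subset_leq_card.
Qed.

Lemma card_chain_idealU C I J : chain C ->
  #|(I :|: J) :&: C| = maxn #|I :&: C| #|J :&: C|.
Proof.
move=> /(@chain_ideal_total _ I J)/orP[] s; rewrite setIUl.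
  by rewrite (setUidPr s); apply/esym/maxn_idPr/subset_leq_card.
by rewrite (setUidPl s); apply/esym/maxn_idPl/subset_leq_card.
Qed.

Lemma card_chain_ideal_inj C I J : chain C ->
  #|I :&: C| = #|J :&: C| -> I :&: C = J :&: C.
Proof.
move=> /(@chain_ideal_total _ I J)/orP[] s e; apply/eqP.
  by rewrite eqEcard s e /=.
by rewrite eq_sym eqEcard s e /=.
Qed.

Definition chain_rank C (x : P) : nat := #|[set y in C | y < x]|.
(** These sets supply a trace of each cardinality, hence the inverse of the map that counts
    traces. *)
Definition initial_segment C (i : nat) : {set P} :=
  [set x in C | (chain_rank C x < i)%N].

Lemma leq_chain_rank C x y : x <= y -> (chain_rank C x <= chain_rank C y)%N.
Proof.
move=> xy; apply/subset_leq_card/subsetP => z; rewrite !inE => /andP[-> /=].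
by move/lt_le_trans; apply.
Qed.

Lemma ltn_chain_rank C x y :
  x \in C -> x < y -> (chain_rank C x < chain_rank C y)%N.
Proof.
move=> xC xy; apply/proper_card/properP; split.
  apply/subsetP => z; rewrite !inE => /andP[-> /=] zx; exact: lt_trans zx xy.
by exists x; rewrite !inE ?xC ?xy // ltxx andbF.
Qed.

Lemma chain_rank_inj C : chain C -> {in C &, injective (chain_rank C)}.
Proof.
move=> chC x y xC yC e; apply/eqP/negPn/negP => ne.
case/orP: (chC _ _ xC yC); rewrite le_eqVlt 1?[y == x]eq_sym (negPf ne) /=.
  by move/(ltn_chain_rank xC); rewrite e ltnn.
by move/(ltn_chain_rank yC); rewrite e ltnn.
Qed.

Lemma chain_rank_lt_card C x : x \in C -> (chain_rank C x < #|C|)%N.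
Proof.
move=> xC; apply/proper_card/properP; split.
  by apply/subsetP => z; rewrite inE => /andP[].
by exists x => //; rewrite inE ltxx andbF.
Qed.

Lemma card_initial_segment C i :
  chain C -> (i <= #|C|)%N -> #|initial_segment C i| = i.
Proof.
move=> chC iC.
have rankE : perm_eq [seq chain_rank C x | x <- enum C] (iota 0 #|C|).
  apply: uniq_perm; rewrite ?iota_uniq //.
    rewrite map_inj_in_uniq ?enum_uniq // => x y.
    by rewrite !mem_enum; apply: chain_rank_inj.
  (* Pigeonhole: [#|C|] distinct ranks, all below [#|C|], exhaust [iota 0 #|C|]. *)
  apply: (uniq_min_size _ _ _).2; rewrite ?size_iota ?size_map -?cardE //.
    rewrite map_inj_in_uniq ?enum_uniq // => x y.
    by rewrite !mem_enum; apply: chain_rank_inj.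
  move=> k /mapP[x]; rewrite mem_enum mem_iota => xC ->.
  exact: chain_rank_lt_card.
transitivity (count (fun k => k < i)%N (iota 0 #|C|)); last first.
  (* Cut at [i]: every index of the first block is counted, none of the second. *)
  rewrite -size_filter -(subnKC iC) iotaD filter_cat size_cat add0n.
  rewrite (@eq_in_filter _ _ predT) ?filter_predT ?size_iota; last first.
    by move=> k; rewrite mem_iota.
  rewrite (@eq_in_filter _ _ pred0) ?filter_pred0 ?addn0 // => k.
  by rewrite mem_iota => /andP[ik _]; rewrite ltnNge ik.
rewrite -(permP rankE) count_map -size_filter cardE /enum_mem size_filter.
rewrite size_filter count_filter; apply: eq_count => x /=.
by rewrite !inE andbC.
Qed.

Lemma val_ord_meet n (i j : 'I_n) : val (i `&` j) = minn i j.
Proof.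
rewrite meetEtotal; case: leP => ij; first by rewrite (minn_idPl ij).
by rewrite (minn_idPr (ltnW ij)).
Qed.

Lemma val_ord_join n (i j : 'I_n) : val (i `|` j) = maxn i j.
Proof.
rewrite joinEtotal; case: leP => ij; first by rewrite (maxn_idPr ij).
by rewrite (maxn_idPl (ltnW ij)).
Qed.

Lemma chains_lattice_isomorphic : disjoint_incomparable_chains P ->
  exists m n : nat, lattice_isomorphic (ideal P) ('I_m.+1 *p 'I_n.+1).
Proof.
move=> [C [D [CD dCD chC chD incCD]]]; exists #|C|, #|D|.
have cardP I E : (#|I :&: E| < #|E|.+1)%N.
  by rewrite ltnS subset_leq_card ?subsetIr.
pose f I : 'I_#|C|.+1 *p 'I_#|D|.+1 :=
  (Ordinal (cardP I C), Ordinal (cardP I D)).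
(* Since traces on a chain are nested, cardinals turn intersection and union into minimum and
   maximum. *)
have fI : {morph f : I J / I `&` J >-> I `&` J}.
  move=> I J; rewrite meetEprod.
  by congr pair; apply: val_inj; rewrite val_ord_meet /= card_chain_idealI.
have fU : {morph f : I J / I `|` J >-> I `|` J}.
  move=> I J; rewrite joinEprod.
  by congr pair; apply: val_inj; rewrite val_ord_join /= card_chain_idealU.
have fle : {homo f : I J / I <= J}.
  by move=> I J; rewrite !leEmeet -fI => /eqP->.
pose fMor := HB.pack_for {lmorphism ideal P -> 'I_#|C|.+1 *p 'I_#|D|.+1} f
  (Order.isOrderMorphism.Build _ _ _ _ f fle)
  (Order.isMeetLatticeMorphism.Build _ _ _ _ f fI)
  (Order.isJoinLatticeMorphism.Build _ _ _ _ f fU).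
(* Incomparability keeps an element below [x] in the same chain as [x], where its rank is no
   larger. *)
have clP i j : is_ideal (initial_segment C i :|: initial_segment D j).
  apply/is_idealP => x y xCD yx.
  have yCD : y \in C :|: D by rewrite CD inE.
  have xy : x >=< y by rewrite /Order.comparable yx orbT.
  move: xCD yCD; rewrite !inE => /orP[] /andP[xE rx] /orP[] yE.
  - by rewrite yE (leq_ltn_trans (leq_chain_rank _ yx) rx).
  - by case/negP: (incCD _ _ xE yE).
  - by case/negP: (incCD _ _ yE xE); rewrite comparable_sym.
  - by rewrite yE (leq_ltn_trans (leq_chain_rank _ yx) rx) orbT.
have segI (E E' : {set P}) i j : [disjoint E & E'] ->
    (initial_segment E i :|: initial_segment E' j) :&: E = initial_segment E i.
  move=> dEE'; apply/setP => x; rewrite !inE.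
  case xE: (x \in E); last by rewrite andbF.
  by rewrite (disjointFr dEE' xE) orbF andbT.
pose g (u : 'I_#|C|.+1 *p 'I_#|D|.+1) := Ideal (clP u.1 u.2).
have gK : cancel g f.
  move=> [i j]; rewrite /f; congr pair; apply: val_inj => /=.
    by rewrite segI // card_initial_segment // -ltnS.
  by rewrite setUC segI 1?disjoint_sym // card_initial_segment // -ltnS.
(* An ideal is the union of its traces on [C] and [D], and each trace is determined by its
   cardinal. *)
have f_inj : injective f.
  move=> I J eIJ; apply: val_inj => /=.
  have eC : #|I :&: C| = #|J :&: C| := congr1 (fun u => val u.1) eIJ.
  have eD : #|I :&: D| = #|J :&: D| := congr1 (fun u => val u.2) eIJ.
  rewrite -[LHS]setIT -[RHS]setIT -CD !setIUr.
  by rewrite (card_chain_ideal_inj chC eC) (card_chain_ideal_inj chD eD).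
by exists fMor, g => // I; apply: f_inj; rewrite gK.
Qed.

End IdealsOfChains.

(** * Order restrictions on a poset whose ideal lattice is URC *)

Section URCIdeal.

Import Order.Theory.
Local Open Scope order_scope.
Context {d : Order.disp_t} {P : finPOrderType d}.
Hypothesis urcP : URC (ideal P).
Implicit Types (x y z : P) (A B C D : ideal P).

(** The interval is not a chain: joining [A] with the principal ideals of [x] and of [y] gives two
    incomparable members. *)
Lemma URC_ideal_incomparable A B x y : A <= B ->
  x \in ideal_set B -> y \in ideal_set B ->
  x \notin ideal_set A -> y \notin ideal_set A -> x >< y ->
  exists! S, complementary_set A B S.
Proof.
move=> AB xB yB xA yA xy; case: (urcP AB) => // tot; exfalso.
have downP (t : P) : is_ideal [set w : P | w <= t].
  by apply/is_idealP => u v; rewrite !inE => ut vu; apply: le_trans ut.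
have inAB t : t \in ideal_set B -> A `|` Ideal (downP t) \in `[A, B].
  move=> tB; rewrite in_itv /= leUl leUx AB leEideal /=.
  by apply/subsetP => w; rewrite inE; apply: ideal_down tB.
move: xy; rewrite /Order.comparable negb_or => /andP[xy yx].
case/orP: (tot _ _ (inAB _ xB) (inAB _ yB)); rewrite leEideal /=.
  move/subsetP/(_ x); rewrite !inE lexx orbT (negPf xA) (negPf xy).
  by move/(_ isT).
move/subsetP/(_ y); rewrite !inE lexx orbT (negPf yA) (negPf yx).
by move/(_ isT).
Qed.

(** Take [B] generated by [x] and [y], and [A] its part not above [z]. Then [z] is least in the
    difference, so an ideal of the interval other than [A] contains [z]; two ideals meeting in [A]
    cannot both do so. *)
Lemma URC_incomparable_no_lower x y z : x >< y -> z <= x -> z <= y -> False.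
Proof.
move=> xy zx zy.
have idB : is_ideal [set w : P | (w <= x) || (w <= y)].
  apply/is_idealP => u v; rewrite !inE => /orP[] ut vu.
    by rewrite (le_trans vu ut).
  by rewrite (le_trans vu ut) orbT.
have idA : is_ideal [set w : P | ((w <= x) || (w <= y)) && ~~ (z <= w)].
  apply/is_idealP => u v; rewrite !inE => /andP[uxy zu] vu.
  have -> : ~~ (z <= v) by apply: contra zu => zv; apply: le_trans zv vu.
  by case/orP: uxy => ut; rewrite (le_trans vu ut) ?orbT.
have AB : Ideal idA <= Ideal idB.
  by rewrite leEideal /=; apply/subsetP => w; rewrite !inE => /andP[].
have [||||//|S [cS _]] := @URC_ideal_incomparable _ _ x y AB.
- by rewrite inE lexx.
- by rewrite inE lexx orbT.
- by rewrite inE zx andbF.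
- by rewrite inE zy andbF.
apply: no_complementary_set cS => C D CDU CDI.
have sub E : Ideal idA <= E -> E <= Ideal idB -> z \notin ideal_set E ->
    E = Ideal idA.
  move=> AE EB zE; apply/le_anti; rewrite AE andbT leEideal /=.
  apply/subsetP => w wE; move: (subsetP EB w wE); rewrite !inE => -> /=.
  by apply: contra zE => zw; apply: ideal_down wE zw.
have : z \notin ideal_set (C `&` D) by rewrite CDI inE lexx andbF.
rewrite meetEideal inE negb_and => /orP[] zN; [left|right]; apply: sub => //.
- by rewrite -CDI leIl.
- by rewrite -CDU leUl.
- by rewrite -CDI leIr.
- by rewrite -CDU leUr.
Qed.

(** Dually, [z] is greatest in the difference of the two ideals: of two ideals with join [B], one
    contains [z] and so equals [B], which makes the other one the meet [A]. *)
Lemma URC_incomparable_no_upper x y z : x >< y -> x <= z -> y <= z -> False.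
Proof.
move=> xy xz yz.
have idB : is_ideal [set w : P | w <= z].
  by apply/is_idealP => u v; rewrite !inE => uz vu; apply: le_trans uz.
have idA : is_ideal [set w : P | (w <= z) && ~~ ((x <= w) || (y <= w))].
  apply/is_idealP => u v; rewrite !inE => /andP[uz xyu] vu.
  rewrite (le_trans vu uz); apply: contra xyu.
  by case/orP=> tv; rewrite (le_trans tv vu) ?orbT.
have AB : Ideal idA <= Ideal idB.
  by rewrite leEideal /=; apply/subsetP => w; rewrite !inE => /andP[].
have [||||//|S [cS _]] := @URC_ideal_incomparable _ _ x y AB.
- by rewrite inE.
- by rewrite inE.
- by rewrite inE lexx andbF.
- by rewrite inE lexx orbT andbF.
apply: no_complementary_set cS => C D CDU CDI.
have full E : z \in ideal_set E -> Ideal idB <= E.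
  move=> zE; rewrite leEideal /=; apply/subsetP => w; rewrite inE.
  exact: ideal_down zE.
have : z \in ideal_set (C `|` D) by rewrite CDU inE lexx.
rewrite joinEideal inE => /orP[] /full BE; [right|left];
  rewrite -CDI; apply/esym.
  by apply/meet_r/(le_trans _ BE); rewrite -CDU leUr.
by apply/meet_l/(le_trans _ BE); rewrite -CDU leUl.
Qed.

Lemma URC_incomparable_not_both x y z : x >< y -> z >=< x -> z >=< y -> False.
Proof.
move=> xy /orP[] zx /orP[] zy.
- exact: URC_incomparable_no_lower zx zy.
- by move: xy; rewrite /Order.comparable (le_trans zy zx) orbT.
- by move: xy; rewrite /Order.comparable (le_trans zx zy).
- exact: URC_incomparable_no_upper zx zy.
Qed.

(** For an antichain [T], these ideals form a copy of the Boolean lattice of subsets of [T]. *)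
Lemma is_ideal_strict_lowerU (T U : {set P}) : U \subset T ->
  is_ideal ([set w : P | [exists t in T, w < t]] :|: U).
Proof.
move=> UT; apply/is_idealP => u v; rewrite !inE => uU vu.
case/orP: uU => [/exists_inP[t tT ut]|uU].
  by apply/orP; left; apply/exists_inP; exists t => //; apply: le_lt_trans ut.
have [->|vneu] := eqVneq v u; first by rewrite uU orbT.
apply/orP; left; apply/exists_inP; exists u; first exact: (subsetP UT).
by rewrite lt_neqAle vneu.
Qed.

Lemma URC_no_3antichain x y z : x >< y -> x >< z -> y >< z -> False.
Proof.
move=> xy xz yz.
pose T := [set x; y; z].
pose lower := [set w : P | [exists t in T, w < t]].
have antiT : {in T &, forall u v, u <= v -> u = v}.
  have ncmp (u v : P) : u >< v -> (u <= v) = false /\ (v <= u) = false.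
    by rewrite /Order.comparable negb_or => /andP[/negPf-> /negPf->].
  have [xy1 xy2] := ncmp _ _ xy; have [xz1 xz2] := ncmp _ _ xz.
  have [yz1 yz2] := ncmp _ _ yz.
  move=> u v; rewrite !inE => /orP[/orP[]|] /eqP-> /orP[/orP[]|] /eqP->;
    by rewrite ?xy1 ?xy2 ?xz1 ?xz2 ?yz1 ?yz2.
have lowerT t : t \in T -> t \notin lower.
  move=> tT; rewrite inE; apply/exists_inP => -[u uT tu].
  by move: (tu); rewrite (antiT _ _ tT uT (ltW tu)) ltxx.
(* Intersecting with [T] makes [K] total on sets, so that it commutes with union and intersection
   without side conditions. *)
pose K U := Ideal (is_ideal_strict_lowerU (subsetIr U T)).
have inK U t : t \in T -> (t \in ideal_set (K U)) = (t \in U).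
  by move=> tT; rewrite /= inE (negPf (lowerT _ tT)) inE tT andbT.
have KU U V : K U `|` K V = K (U :|: V).
  by apply: val_inj; rewrite /= -setUUr -setIUl.
have KI U V : K U `&` K V = K (U :&: V).
  by apply: val_inj; rewrite /= -setUIr -setIIl.
have [xT yT zT] : [/\ x \in T, y \in T & z \in T] by rewrite !inE !eqxx !orbT.
have [yx zx zy] : [/\ y != x, z != x & z != y].
  by split; apply/eqP => e; move: xy xz yz; rewrite e comparablexx.
have KP U V t : t \in T -> K U = K V -> (t \in U) = (t \in V).
  by move=> tT eUV; rewrite -(inK U) // eUV inK.
have K0T U : K set0 <= K U <= K T.
  rewrite !leEmeet !KI set0I eqxx /=.
  by apply/eqP/val_inj; rewrite /= -setIA setIid.
(* The witness [p] separates [K U] from the bottom of the interval, and [q] separates it from the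
   top. *)
have compl U V p q : U :|: V = T -> U :&: V = set0 -> p \in T -> q \in T ->
    p \in U -> q \notin U ->
    complementary_set (K set0) (K T) [fset K U; K V]%fset.
  move=> UV UV0 pT qT pU qU; exists (K U), (K V).
  split; rewrite ?KU ?KI ?UV ?UV0 ?in_itv ?K0T //.
  apply/eqP => e; move: (fset21 (K U) (K V)); rewrite e in_fset2 => /orP[] /eqP.
    by move/(KP _ _ _ pT); rewrite pU inE.
  by move/(KP _ _ _ qT); rewrite (negPf qU) qT.
have /andP[le0T _] := K0T T.
have [S [_ uniqS]] : exists! S, complementary_set (K set0) (K T) S.
  by apply: (URC_ideal_incomparable le0T _ _ _ _ xy); rewrite inK // inE.
have Sx : S = [fset K [set x]; K [set y; z]]%fset.
  apply/uniqS/(compl _ _ x y) => //; rewrite ?inE //.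
    by rewrite setUA.
  by apply/setP => t; rewrite !inE; case: eqP => // ->;
    rewrite ![x == _]eq_sym (negPf yx) (negPf zx).
have Sy : S = [fset K [set y]; K [set x; z]]%fset.
  apply/uniqS/(compl _ _ y x) => //; rewrite ?inE // 1?eq_sym //.
    by rewrite setUCA setUA.
  by apply/setP => t; rewrite !inE; case: eqP => // ->;
    rewrite (negPf yx) eq_sym (negPf zy).
(* The two descriptions of [S] clash: [K [set x]] differs from [K [set y]] at [x] and from [K
   [set x; z]] at [z]. *)
have : K [set x] \in S by rewrite Sx in_fset2 eqxx.
rewrite Sy in_fset2 => /orP[] /eqP.
  by move/(KP _ _ _ xT); rewrite !inE eqxx eq_sym (negPf yx).
by move/(KP _ _ _ zT); rewrite !inE eqxx orbT (negPf zx).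
Qed.

Lemma URC_ideal_chains : chain [set: P] \/ disjoint_incomparable_chains P.
Proof.
have [tot|] := boolP [forall x : P, forall y : P, x >=< y].
  by left=> x y _ _; apply: (forallP (forallP tot x) y).
case/forallPn => x /forallPn[y xy]; right.
have yx : y >< x by rewrite comparable_sym.
(* Two incomparable elements in the first set would both be comparable with [x], which is forbidden;
   likewise for [y] in the second. *)
exists [set z | z >=< x], [set z | z >=< y]; split.
- apply/setP => z; rewrite !inE; apply/negPn/negP; rewrite negb_or.
  case/andP=> zx zy.
  by apply: (URC_no_3antichain xy (z := z)); rewrite comparable_sym.
- rewrite disjoint_subset; apply/subsetP => z; rewrite !inE => zx.
  by apply/negP => zy; apply: URC_incomparable_not_both zx zy.
- move=> u v; rewrite !inE => ux vx; apply/negPn/negP => uv.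
  by apply: (URC_incomparable_not_both uv (z := x)); rewrite comparable_sym.
- move=> u v; rewrite !inE => ux vx; apply/negPn/negP => uv.
  by apply: (URC_incomparable_not_both uv (z := y)); rewrite comparable_sym.
move=> u v; rewrite !inE => ux vy; apply/negP => uv.
(* If [v] is comparable with [x], it is so with both [x] and [y]; if not, [u] is comparable with
   both of the incomparable [v] and [x]. *)
have [vx|vx] := boolP (v >=< x); first exact: URC_incomparable_not_both vx vy.
exact: URC_incomparable_not_both vx uv ux.
Qed.

End URCIdeal.

Theorem proposition1p7 (d : Order.disp_t) (P : finPOrderType d) :
  [<-> URC (ideal P);
       chain [set: P] \/ disjoint_incomparable_chains P;
       exists m n : nat, lattice_isomorphic (ideal P) ('I_m.+1 *p 'I_n.+1)].
Proof.
tfae.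
- exact: URC_ideal_chains.
- case=> [chP|]; last exact: chains_lattice_isomorphic.
  (* A single chain is the case of an empty second chain. *)
  apply: chains_lattice_isomorphic; exists setT, set0.
  split=> //; first by rewrite setU0.
  - by rewrite disjoints_subset setC0.
  - by move=> x y; rewrite inE.
  - by move=> x y _; rewrite inE.
- by move=> [m [n iso]]; apply: URC_prod_iso iso.
Qed.
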